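(* Let $p\in\mathbb{R}$ and let $p_0=\dfrac{\ln 2}{\ln\ln(3+2\sqrt{2})}\approx 1.2228$. For $a,b>0$ with $a\neq b$, the inequality $N(a,b)>A_p(a,b)$ holds (for all such $a,b$) if and only if $p\leq p_0$. Moreover, for all $a,b>0$ with $a\neq b$, $$\alpha_2 A_{p_0}(a,b)<N(a,b)<\beta_2 A_{p_0}(a,b),$$ where $\alpha_2=1$ and $\beta_2\approx 1.0138$ are the best possible constants.
   Context: For $a,b>0$ with $a\neq b$, the Neuman–Sándor mean is $$N(a,b)=\frac{a-b}{2\,\mathrm{arcsinh}\frac{a-b}{a+b}}=\frac{a-b}{2\ln\frac{a-b+\sqrt{2(a^2+b^2)}}{a+b}}.$$ The power mean of order $r\in\mathbb{R}$ is $A_r(a,b)=\left(\frac{a^r+b^r}{2}\right)^{1/r}$ if $r\neq 0$, and $A_0(a,b)=\sqrt{ab}$. The constant $\beta_2$ is specified by being the best possible constant in the upper bound, with approximate numerical value $1.0138$.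
   Formalization: The upper bound is proved as N(a,b) ≤ β₂A_{p₀}(a,b) instead of strictly: N/A_{p₀} tends to 1 as a/b→1 and as a/b→∞ and attains its maximum β₂ > 1 (near a/b ≈ 6.33), so the strict bound fails there for the best constant β₂. *)

(* Defs.v *)
From Stdlib Require Import Reals.
Open Scope R_scope.

(* Stdlib's [arcsinh x] is [ln (x + sqrt (x ^ 2 + 1))].  The value at a = b is
   junk; the mean is only used for a <> b. *)
Definition NS_mean (a b : R) : R :=
  (a - b) / (2 * arcsinh ((a - b) / (a + b))).

Definition power_mean (r a b : R) : R :=
  if Req_EM_T r 0 then sqrt (a * b)
  else Rpower ((Rpower a r + Rpower b r) / 2) (1 / r).

Definition p0 : R := ln 2 / ln (ln (3 + 2 * sqrt 2)).

(* Main.v *)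
Require Import Defs.
From Stdlib Require Import Reals Lra.
From Coquelicot Require Import Coquelicot.
Open Scope R_scope.

(** Write [a = m e^s] and [b = m e^(-s)] with [s > 0].  Then [N / A_p = exp f] with
    [f = ln sinh s - ln arcsinh (tanh s) - ln cosh (p s) / p], and [f'] is a
    positive multiple of
    [g = arcsinh (tanh s) - tanh s cosh (p s) / (cosh ((p-1) s) sqrt (cosh 2s))].
    In turn [g'] is a positive multiple of a linear combination [H] of
    hyperbolic cosines whose fourth derivative is negative and for which
    [H(0) = H'(0) = H'''(0) = 0 < H''(0)].  "Once nonpositive, negative ever
    after" passes from a derivative to a function that is nonnegative at [0],
    so it climbs from [H''''] up to [g]: [f] first increases, then decreases.
    It tends to [0] at [0], and at infinity to [ln 2 / p - ln ln (3 + 2 sqrt 2)],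
    which vanishes exactly for [p = p0]; hence [f > 0] for [p = p0].

    The constant [beta2] is the supremum of [exp f] at [p = p0]; its decimals
    come from evaluating [f] and [g] at [ln (5/2)] and [ln (13/5)], which
    surround the maximum of [f]. *)

(** * Monotonicity and propagation of signs from derivatives *)

Lemma is_derive_arcsinh (x : R) : is_derive arcsinh x (/ sqrt (x ^ 2 + 1)).
Proof. apply is_derive_Reals, derivable_pt_lim_arcsinh. Qed.

#[local] Instance UnaryDiff_arcsinh : AutoDerive.UnaryDiff arcsinh :=
  AutoDerive.Build_UnaryDiff arcsinh _ is_derive_arcsinh.

Lemma MVT_is_derive (f df : R -> R) (a b : R) :
  a < b -> (forall x, a <= x <= b -> is_derive f x (df x)) ->
  exists c, a < c < b /\ f b - f a = df c * (b - a).
Proof.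
  intros Hab Hd.
  destruct (MVT_cor2 f df a b Hab) as [c [H1 H2]].
  - intros x Hx. apply is_derive_Reals, Hd, Hx.
  - exists c. now split.
Qed.

Lemma increasing_of_deriv_pos (f df : R -> R) (a b : R) :
  a < b -> (forall x, a <= x <= b -> is_derive f x (df x)) ->
  (forall x, a < x < b -> 0 < df x) -> f a < f b.
Proof.
  intros Hab Hd Hp. destruct (MVT_is_derive f df a b Hab Hd) as [c [Hc E]].
  assert (0 < df c * (b - a)) by (apply Rmult_lt_0_compat; [auto | lra]). lra.
Qed.

Lemma decreasing_of_deriv_neg (f df : R -> R) (a b : R) :
  a < b -> (forall x, a <= x <= b -> is_derive f x (df x)) ->
  (forall x, a < x < b -> df x < 0) -> f b < f a.
Proof.
  intros Hab Hd Hp. destruct (MVT_is_derive f df a b Hab Hd) as [c [Hc E]].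
  assert (0 < - df c * (b - a))
    by (apply Rmult_lt_0_compat; [specialize (Hp c Hc) |]; lra). lra.
Qed.

Definition stays_negative (F : R -> R) : Prop :=
  forall s t, 0 < s -> s < t -> F s <= 0 -> F t < 0.

(** If [F s <= 0 <= F 0], the mean value theorem gives a point [c < s] where [dF] is nonpositive.
    Hence [dF] is negative beyond [c], in particular beyond [s], and [F] decreases strictly from
    there. *)
Lemma stays_negative_of_deriv (F dF : R -> R) :
  (forall x, 0 <= x -> is_derive F x (dF x)) -> 0 <= F 0 ->
  stays_negative dF -> stays_negative F.
Proof.
  intros Hd H0 HdF s t Hs Hst HFs.
  destruct (MVT_is_derive F dF 0 s Hs) as [c [Hc E]].
  { intros x Hx. apply Hd. lra. }
  assert (Hdc : dF c <= 0).
  { apply Rnot_lt_le. intro Hp.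
    assert (0 < dF c * (s - 0)) by (apply Rmult_lt_0_compat; lra). lra. }
  enough (F t < F s) by lra.
  apply decreasing_of_deriv_neg with dF; [exact Hst | |].
  - intros x Hx. apply Hd. lra.
  - intros x Hx. apply (HdF c); lra.
Qed.

(** * Hyperbolic functions *)

Lemma cosh_pos (x : R) : 0 < cosh x.
Proof. unfold cosh. pose proof (exp_pos x). pose proof (exp_pos (- x)). lra. Qed.

Lemma sinh_pos (x : R) : 0 < x -> 0 < sinh x.
Proof. intro Hx. rewrite <- sinh_0. now apply sinh_lt. Qed.

Lemma cosh_lt (x y : R) : 0 <= x -> x < y -> cosh x < cosh y.
Proof.
  intros Hx Hxy. apply increasing_of_deriv_pos with sinh; [exact Hxy | |].
  - intros z _. apply is_derive_Reals, derivable_pt_lim_cosh.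
  - intros z Hz. apply sinh_pos. lra.
Qed.

Lemma cosh_le (x y : R) : 0 <= x -> x <= y -> cosh x <= cosh y.
Proof.
  intros Hx [Hxy | ->]; [apply Rlt_le; now apply cosh_lt | lra].
Qed.

Lemma cosh_ge_1 (x : R) : 0 <= x -> 1 <= cosh x.
Proof. intro Hx. rewrite <- cosh_0. apply cosh_le; lra. Qed.

Lemma cosh_sqr_minus_sinh_sqr (x : R) : cosh x * cosh x - sinh x * sinh x = 1.
Proof.
  unfold cosh, sinh. rewrite exp_Ropp. pose proof (exp_pos x). field. lra.
Qed.

Lemma is_derive_tanh (x : R) : is_derive tanh x (/ cosh x ^ 2).
Proof.
  pose proof (cosh_pos x) as Hx. unfold tanh. auto_derive; [lra|].
  transitivity ((cosh x * cosh x - sinh x * sinh x) / cosh x ^ 2); [field; lra|].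
  rewrite cosh_sqr_minus_sinh_sqr. field. lra.
Qed.

Lemma tanh_lt (x y : R) : x < y -> tanh x < tanh y.
Proof.
  intro Hxy.
  apply (increasing_of_deriv_pos tanh (fun x => / cosh x ^ 2)); [exact Hxy | |].
  - intros z _. apply is_derive_tanh.
  - intros z _. apply Rinv_0_lt_compat, pow_lt, cosh_pos.
Qed.

(** * The logarithm of the ratio of the means and its derivatives *)

Definition log_ratio (p s : R) : R :=
  ln (sinh s) - ln (arcsinh (tanh s)) - ln (cosh (p * s)) / p.

Definition slope (p s : R) : R :=
  arcsinh (tanh s)
  - tanh s * cosh (p * s) / (cosh ((p - 1) * s) * sqrt (cosh (2 * s))).

(** The combination [H] of the overview, with [r] standing for [2 * p - 1]: the numerator of the
    derivative of [slope p], with its products turned into sums of hyperbolic cosines. *)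
Definition slope_numer (r s : R) : R :=
  (1 - r) * cosh (5 * s) + (1 + r) * cosh (3 * s) + 4 * cosh ((4 - r) * s)
  - 2 * cosh ((2 + r) * s) - 2 * cosh ((2 - r) * s) - 2 * cosh s.

Definition slope_denom (p s : R) : R :=
  16 * cosh (2 * s) * sqrt (cosh (2 * s)) * cosh s ^ 2 * cosh ((p - 1) * s) ^ 2.

Lemma slope_denom_pos (p s : R) : 0 < slope_denom p s.
Proof.
  pose proof (cosh_pos (2 * s)) as Hc.
  do 2 (apply Rmult_lt_0_compat; [|apply pow_lt, cosh_pos]).
  apply Rmult_lt_0_compat; [lra | now apply sqrt_lt_R0].
Qed.

Lemma tanh_pos (s : R) : 0 < s -> 0 < tanh s.
Proof.
  intro Hs. apply Rdiv_lt_0_compat; [now apply sinh_pos | apply cosh_pos].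
Qed.

Lemma arcsinh_pos (x : R) : 0 < x -> 0 < arcsinh x.
Proof. intro Hx. rewrite <- arcsinh_0. now apply arcsinh_lt. Qed.

(** Divide [cosh (2 * s) = cosh s ^ 2 + sinh s ^ 2] by [cosh s ^ 2]. *)
Lemma sqrt_tanh_sqr_plus_1 (s : R) :
  sqrt (tanh s ^ 2 + 1) = sqrt (cosh (2 * s)) / cosh s.
Proof.
  pose proof (cosh_pos s) as Hc.
  rewrite <- (sqrt_Rsqr (cosh s)) at 1 by lra.
  rewrite <- sqrt_div_alt by (apply Rlt_0_sqr; lra).
  f_equal. unfold tanh, Rsqr, sinh, cosh in *.
  replace (2 * s) with (s + s) by ring.
  rewrite Ropp_plus_distr, !exp_plus, exp_Ropp in *.
  pose proof (exp_pos s). field. split; [lra|]. nra.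
Qed.

Lemma is_derive_arcsinh_tanh (s : R) :
  is_derive (fun x => arcsinh (tanh x)) s (/ (cosh s * sqrt (cosh (2 * s)))).
Proof.
  pose proof (cosh_pos s) as Hc. pose proof (cosh_pos (2 * s)) as Hc2.
  pose proof (sqrt_lt_R0 _ Hc2) as HW.
  evar_last.
  { apply (is_derive_comp arcsinh tanh);
      [apply is_derive_arcsinh | apply is_derive_tanh]. }
  unfold scal; simpl; unfold mult; simpl.
  pose proof (sqrt_tanh_sqr_plus_1 s) as E. simpl in E. rewrite E.
  field. split; lra.
Qed.

Lemma is_derive_slope (p s : R) :
  is_derive (slope p) s
    (slope_numer (2 * p - 1) s / slope_denom p s).
Proof.
  unfold slope_denom.
  pose proof (cosh_pos s) as Hc. pose proof (cosh_pos (2 * s)) as Hc2.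
  pose proof (cosh_pos ((p - 1) * s)) as Hq.
  pose proof (sqrt_lt_R0 _ Hc2) as HW.
  unfold slope.
  evar_last.
  { apply (is_derive_minus (fun s => arcsinh (tanh s))).
    - apply is_derive_arcsinh_tanh.
    - unfold tanh. auto_derive.
      + repeat split; try lra. apply Rmult_integral_contrapositive_currified; lra.
      + reflexivity. }
  match goal with |- ?x = _ => set (lhs := x) end. 
  unfold minus, plus, opp in lhs; simpl in lhs. subst lhs.
  assert (E : sqrt (cosh (2 * s)) * sqrt (cosh (2 * s)) = cosh (2 * s))
    by (apply sqrt_sqrt; lra).
  set (W := sqrt (cosh (2 * s))) in *.
  (* [K] is the numerator over the common denominator, with [W * W] written as [cosh (2 * s)]. *)
  set (K := cosh (2 * s) * cosh s * cosh ((p - 1) * s) ^ 2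
    - cosh (2 * s) * cosh ((p - 1) * s)
      * ((cosh s ^ 2 - sinh s ^ 2) * cosh (p * s)
         + sinh s * cosh s * (p * sinh (p * s)))
    + sinh s * cosh s * cosh (p * s)
      * ((p - 1) * sinh ((p - 1) * s) * cosh (2 * s)
         + cosh ((p - 1) * s) * sinh (2 * s))).
  transitivity (K / (cosh (2 * s) * W * cosh s ^ 2 * cosh ((p - 1) * s) ^ 2)).
  - unfold K. rewrite <- E. field. repeat split; lra.
  (* Every argument is an integer combination of [s] and [p * s], so in terms of [exp s] and
     [exp (p * s)] this is an identity of rational functions. *)
  - assert (EK : slope_numer (2 * p - 1) s = 16 * K).
    { unfold K, slope_numer, cosh, sinh.
      replace (5 * s) with (s + s + s + s + s) by ring.
      replace (3 * s) with (s + s + s) by ring.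
      replace (2 * s) with (s + s) by ring.
      replace ((4 - (2 * p - 1)) * s)
        with (s + s + s + s + s - p * s - p * s) by ring.
      replace ((2 + (2 * p - 1)) * s) with (s + p * s + p * s) by ring.
      replace ((2 - (2 * p - 1)) * s)
        with (s + s + s - p * s - p * s) by ring.
      replace ((p - 1) * s) with (p * s - s) by ring.
      unfold Rminus. rewrite ?Ropp_plus_distr, ?Ropp_involutive, !exp_plus, !exp_Ropp.
      pose proof (exp_pos s). pose proof (exp_pos (p * s)).
      field. split; lra. }
    rewrite EK. field. repeat split; lra.
Qed.

Lemma stays_negative_slope_numer (r : R) :
  14 / 10 <= r <= 15 / 10 -> stays_negative (slope_numer r).
Proof.
  intro Hr.
  set (D1 := fun s => (1 - r) * 5 * sinh (5 * s) + (1 + r) * 3 * sinh (3 * s)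
    + 4 * (4 - r) * sinh ((4 - r) * s) - 2 * (2 + r) * sinh ((2 + r) * s)
    - 2 * (2 - r) * sinh ((2 - r) * s) - 2 * sinh s).
  set (D2 := fun s => (1 - r) * 5 ^ 2 * cosh (5 * s)
    + (1 + r) * 3 ^ 2 * cosh (3 * s)
    + 4 * (4 - r) ^ 2 * cosh ((4 - r) * s)
    - 2 * (2 + r) ^ 2 * cosh ((2 + r) * s)
    - 2 * (2 - r) ^ 2 * cosh ((2 - r) * s) - 2 * cosh s).
  set (D3 := fun s => (1 - r) * 5 ^ 3 * sinh (5 * s)
    + (1 + r) * 3 ^ 3 * sinh (3 * s)
    + 4 * (4 - r) ^ 3 * sinh ((4 - r) * s)
    - 2 * (2 + r) ^ 3 * sinh ((2 + r) * s)
    - 2 * (2 - r) ^ 3 * sinh ((2 - r) * s) - 2 * sinh s).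
  set (D4 := fun s => (1 - r) * 5 ^ 4 * cosh (5 * s)
    + (1 + r) * 3 ^ 4 * cosh (3 * s)
    + 4 * (4 - r) ^ 4 * cosh ((4 - r) * s)
    - 2 * (2 + r) ^ 4 * cosh ((2 + r) * s)
    - 2 * (2 - r) ^ 4 * cosh ((2 - r) * s) - 2 * cosh s).
  apply stays_negative_of_deriv with D1.
  { intros x _. unfold slope_numer, D1. auto_derive; [easy | ring]. }
  { unfold slope_numer. rewrite !Rmult_0_r, cosh_0. lra. }
  apply stays_negative_of_deriv with D2.
  { intros x _. unfold D1, D2. auto_derive; [easy | ring]. }
  { unfold D1. rewrite !Rmult_0_r, sinh_0. lra. }
  apply stays_negative_of_deriv with D3.
  { intros x _. unfold D2, D3. auto_derive; [easy | ring]. }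
  (* The value at [0] is [80 - 48 * r], positive for [r < 5/3]. *)
  { unfold D2. rewrite !Rmult_0_r, cosh_0. nra. }
  apply stays_negative_of_deriv with D4.
  { intros x _. unfold D3, D4. auto_derive; [easy | ring]. }
  { unfold D3. rewrite !Rmult_0_r, sinh_0. lra. }
  intros s t Hs Hst _. unfold D4.
  (* The fourth derivative is negative outright. Each positive term is absorbed by a negative one of
     higher frequency: [3] by [2 + r], and [4 - r] by [5]. The coefficients allow it:
     [81 * 2.5 < 2 * 133] and [4 * 46 < 0.4 * 625]. *)
  assert (H3 : cosh (3 * t) <= cosh ((2 + r) * t)) by (apply cosh_le; nra).
  assert (H5 : cosh ((4 - r) * t) <= cosh (5 * t)) by (apply cosh_le; nra).
  pose proof (cosh_pos (3 * t)). pose proof (cosh_pos ((4 - r) * t)).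
  pose proof (cosh_pos ((2 - r) * t)). pose proof (cosh_pos t).
  assert (C4 : (4 - r) ^ 4 <= 46).
  { assert ((4 - r) ^ 2 <= 6.77) by nra.
    replace ((4 - r) ^ 4) with ((4 - r) ^ 2 * (4 - r) ^ 2) by ring.
    pose proof (pow2_ge_0 (4 - r)). nra. }
  assert (C2 : 133 <= (2 + r) ^ 4).
  { assert (11.56 <= (2 + r) ^ 2) by nra.
    replace ((2 + r) ^ 4) with ((2 + r) ^ 2 * (2 + r) ^ 2) by ring. nra. }
  assert (C0 : forall x, 0 <= x ^ 4).
  { intro x. replace (x ^ 4) with ((x ^ 2) ^ 2) by ring. apply pow2_ge_0. }
  pose proof (C0 (4 - r)). pose proof (C0 (2 - r)).
  assert ((1 + r) * 3 ^ 4 * cosh (3 * t) <= 2 * (2 + r) ^ 4 * cosh ((2 + r) * t)).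
  { apply Rmult_le_compat; lra. }
  assert (4 * (4 - r) ^ 4 * cosh ((4 - r) * t) <= (r - 1) * 5 ^ 4 * cosh (5 * t)).
  { apply Rmult_le_compat; lra. }
  assert (0 <= (2 - r) ^ 4 * cosh ((2 - r) * t)) by (apply Rmult_le_pos; lra).
  lra.
Qed.

Lemma stays_negative_slope (p : R) :
  12 / 10 <= p <= 125 / 100 -> stays_negative (slope p).
Proof.
  intro Hp. eapply stays_negative_of_deriv.
  - intros x _. apply is_derive_slope.
  - unfold slope, tanh. rewrite sinh_0, !Rmult_0_r, Rdiv_0_l, arcsinh_0. lra.
  - intros s t Hs Hst.
    intro Hle. apply Rdiv_neg_pos; [|apply slope_denom_pos].
    apply (stays_negative_slope_numer (2 * p - 1)) with s; try lra.
    apply Rnot_lt_le. intro Hc. apply Rle_not_lt in Hle. apply Hle.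
    apply Rdiv_lt_0_compat; [exact Hc | apply slope_denom_pos].
Qed.

Definition slope_weight (p s : R) : R :=
  cosh ((p - 1) * s) / (sinh s * cosh (p * s) * arcsinh (tanh s)).

Lemma slope_weight_pos (p s : R) : 0 < s -> 0 < slope_weight p s.
Proof.
  intro Hs. unfold slope_weight.
  apply Rdiv_lt_0_compat; [apply cosh_pos|].
  apply Rmult_lt_0_compat; [|now apply arcsinh_pos, tanh_pos].
  apply Rmult_lt_0_compat; [now apply sinh_pos | apply cosh_pos].
Qed.

Lemma is_derive_log_ratio (p s : R) :
  p <> 0 -> 0 < s ->
  is_derive (log_ratio p) s (slope_weight p s * slope p s).
Proof.
  intros Hp Hs. unfold log_ratio.
  pose proof (cosh_pos s) as Hc. pose proof (cosh_pos (p * s)) as Hcp.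
  pose proof (cosh_pos ((p - 1) * s)) as Hq.
  pose proof (sinh_pos s Hs) as Hsh.
  pose proof (arcsinh_pos _ (tanh_pos s Hs)) as HL.
  pose proof (sqrt_lt_R0 _ (cosh_pos (2 * s))) as HW.
  evar_last.
  { apply (is_derive_minus (fun s => ln (sinh s) - ln (arcsinh (tanh s)))
             (fun s => ln (cosh (p * s)) / p)).
    - apply (is_derive_minus (fun s => ln (sinh s)) (fun s => ln (arcsinh (tanh s)))).
      + auto_derive; [exact Hsh | reflexivity].
      + apply (is_derive_comp ln (fun s => arcsinh (tanh s))).
        * apply is_derive_ln. exact HL.
        * apply is_derive_arcsinh_tanh.
    - auto_derive; [easy | reflexivity]. }
  unfold minus, plus, opp, scal; simpl. unfold mult; simpl.
  unfold slope_weight, slope.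
  set (L := arcsinh (tanh s)) in *. set (W := sqrt (cosh (2 * s))) in *.
  assert (E : cosh ((p - 1) * s) = cosh (p * s) * cosh s - sinh (p * s) * sinh s).
  { unfold cosh, sinh. replace ((p - 1) * s) with (p * s - s) by ring.
    unfold Rminus. rewrite Ropp_plus_distr, Ropp_involutive, !exp_plus, !exp_Ropp.
    pose proof (exp_pos s). pose proof (exp_pos (p * s)). field. split; lra. }
  unfold tanh.
  (* The first and last logarithms contribute [coth s - tanh (p * s)], whose numerator over
     [sinh s * cosh (p * s)] is [cosh ((p - 1) * s)] by the subtraction formula. *)
  transitivity ((cosh (p * s) * cosh s - sinh (p * s) * sinh s)
                / (sinh s * cosh (p * s)) - / (cosh s * W * L)).
  - field. repeat split; lra.
  - rewrite <- E. field. repeat split; lra.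
Qed.

Lemma slope_decreasing (p a b : R) :
  12 / 10 <= p <= 125 / 100 -> 0 < a -> a < b ->
  slope_numer (2 * p - 1) a <= 0 -> slope p b < slope p a.
Proof.
  intros Hp Ha Hab Hn. eapply decreasing_of_deriv_neg; [exact Hab | |].
  - intros x _. apply is_derive_slope.
  - intros x Hx. apply Rdiv_neg_pos; [|apply slope_denom_pos].
    apply (stays_negative_slope_numer (2 * p - 1) ltac:(lra) a); lra.
Qed.

(** * Behaviour at infinity and near zero; positivity of the log ratio *)

Lemma exp_le (x y : R) : x <= y -> exp x <= exp y.
Proof. intros [H | ->]; [now apply Rlt_le, exp_increasing | lra]. Qed.

Lemma filterlim_exp_opp (k : R) :
  0 < k -> filterlim (fun s => exp (- (k * s))) (Rbar_locally p_infty) (locally 0).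
Proof.
  intro Hk.
  apply filterlim_comp with (Rbar_locally m_infty).
  - intros P [M HM]. exists (- M / k). intros x Hx. apply HM.
    apply Rmult_lt_compat_l with (r := k) in Hx; [|exact Hk].
    replace (k * (- M / k)) with (- M) in Hx by (field; lra). lra.
  - apply is_lim_exp_m.
Qed.

(** [3 + 2 * sqrt 2] is the square of [1 + sqrt 2]. This ties the constant in [p0] to the limit
    [arcsinh 1] of [arcsinh (tanh s)]. *)
Lemma ln_3_2sqrt2 : ln (3 + 2 * sqrt 2) = 2 * arcsinh 1.
Proof.
  unfold arcsinh. replace (1 ^ 2 + 1) with 2 by ring.
  pose proof (sqrt_lt_R0 2 ltac:(lra)) as H. pose proof (sqrt_sqrt 2 ltac:(lra)) as E.
  replace (3 + 2 * sqrt 2) with ((1 + sqrt 2) * (1 + sqrt 2)) by (ring_simplify; nra).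
  rewrite ln_mult by lra. ring.
Qed.

Lemma is_lim_log_ratio (p : R) :
  0 < p ->
  is_lim (log_ratio p) p_infty (ln 2 / p - ln (ln (3 + 2 * sqrt 2))).
Proof.
  intro Hp.
  (* Factoring [exp s] out of [sinh s] and [exp (p * s)] out of [cosh (p * s)] cancels the linear
     growth. What remains depends continuously on [exp (- (2 * s))] and [exp (- (2 * p * s))], both
     tending to [0]. *)
  set (F := fun y => ln (1 - y) - ln (arcsinh ((1 - y) / (1 + y)))).
  set (G := fun z => ln 2 / p - ln 2 - ln (1 + z) / p).
  pose proof (arcsinh_pos 1 Rlt_0_1) as H1.
  assert (E : ln 2 / p - ln (ln (3 + 2 * sqrt 2)) = F 0 + G 0).
  { unfold F, G. rewrite ln_3_2sqrt2, ln_mult by lra.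
    rewrite Rminus_0_r, Rplus_0_r, Rdiv_1_r, ln_1. lra. }
  rewrite E.
  apply is_lim_ext_loc
    with (fun s => F (exp (- (2 * s))) + G (exp (- (2 * p * s)))).
  - exists 0. intros s Hs. unfold F, G, log_ratio.
    set (X := exp s). set (Y := exp (p * s)).
    assert (HX : 1 < X) by (unfold X; rewrite <- exp_0; now apply exp_increasing).
    assert (HY : 0 < Y) by apply exp_pos.
    assert (EX : exp (- (2 * s)) = / (X * X)).
    { unfold X. rewrite <- exp_plus, <- exp_Ropp. f_equal. ring. }
    assert (EY : exp (- (2 * p * s)) = / (Y * Y)).
    { unfold Y. rewrite <- exp_plus, <- exp_Ropp. f_equal. ring. }
    rewrite EX, EY.
    assert (HXi : / (X * X) < 1).
    { rewrite <- Rinv_1. apply Rinv_lt_contravar; nra. }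
    assert (HYi : 0 < / (Y * Y)) by (apply Rinv_0_lt_compat; nra).
    assert (Et : (1 - / (X * X)) / (1 + / (X * X)) = tanh s).
    { unfold tanh, sinh, cosh. rewrite exp_Ropp. fold X. field.
      repeat split; nra. }
    rewrite Et.
    assert (Es : ln (sinh s) = ln (1 - / (X * X)) + s - ln 2).
    { replace (sinh s) with ((1 - / (X * X)) * X / 2)
        by (unfold sinh; rewrite exp_Ropp; fold X; field; lra).
      unfold Rdiv. rewrite !ln_mult, ln_Rinv by (try apply Rmult_lt_0_compat; lra).
      unfold X. rewrite ln_exp. ring. }
    assert (Ec : ln (cosh (p * s)) = ln (1 + / (Y * Y)) + p * s - ln 2).
    { replace (cosh (p * s)) with ((1 + / (Y * Y)) * Y / 2)
        by (unfold cosh; rewrite exp_Ropp; fold Y; field; lra).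
      unfold Rdiv. rewrite !ln_mult, ln_Rinv by (try apply Rmult_lt_0_compat; lra).
      unfold Y. rewrite ln_exp. ring. }
    rewrite Es, Ec. field. lra.
  - apply is_lim_plus'.
    + apply (filterlim_comp _ _ _ (fun s => exp (- (2 * s))) F _ (locally 0)).
      * apply filterlim_exp_opp. lra.
      * apply (ex_derive_continuous F). unfold F. auto_derive.
        repeat split; try lra.
        replace ((1 + - 0) * / (1 + 0)) with 1 by field. exact H1.
    + apply (filterlim_comp _ _ _ (fun s => exp (- (2 * p * s))) G _ (locally 0)).
      * apply filterlim_exp_opp. lra.
      * apply (ex_derive_continuous G). unfold G. auto_derive.
        repeat split; lra.
Qed.

(** A crude substitute for the limit at [0]: it only prevents values bounded away from zero on the
    negative side. It follows from [arcsinh (tanh s) < tanh s <= sinh s] and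
    [cosh (p * s) <= exp (p * s)]. *)
Lemma log_ratio_ge_opp (p s : R) : 0 < p -> 0 < s -> - s <= log_ratio p s.
Proof.
  intros Hp Hs. unfold log_ratio.
  pose proof (cosh_pos s) as Hc. pose proof (sinh_pos s Hs) as Hsh.
  pose proof (tanh_pos s Hs) as Ht. pose proof (arcsinh_pos _ Ht) as HL.
  assert (Ha : arcsinh (tanh s) < tanh s).
  { rewrite <- (sinh_arcsinh (tanh s)) at 2.
    set (L := arcsinh (tanh s)) in *.
    enough (sinh 0 - 0 < sinh L - L) by (rewrite sinh_0 in *; lra).
    apply (increasing_of_deriv_pos (fun x => sinh x - x) (fun x => cosh x - 1));
      [exact HL | |].
    - intros x _. auto_derive; [easy | ring].
    - intros x Hx. rewrite <- cosh_0. pose proof (cosh_lt 0 x). lra. }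
  assert (H1 : ln (arcsinh (tanh s)) <= ln (sinh s)).
  { apply Rlt_le, ln_increasing; [exact HL|].
    apply Rlt_le_trans with (1 := Ha). unfold tanh.
    apply Rle_div_l; [exact Hc|].
    pose proof (cosh_ge_1 s (Rlt_le _ _ Hs)). nra. }
  assert (H2 : ln (cosh (p * s)) / p <= s).
  { apply Rle_div_l; [exact Hp|].
    rewrite <- (ln_exp (s * p)). apply ln_le; [apply cosh_pos|].
    unfold cosh. replace (s * p) with (p * s) by ring.
    assert (exp (- (p * s)) < exp (p * s)) by (apply exp_increasing; nra). lra. }
  lra.
Qed.

(** Suppose the value at [s] is nonpositive. A slope positive on all of [(0, s)] would force values
    near [0] below a negative constant. So the slope is nonpositive somewhere before [s], the
    function decreases strictly from [s] on, and its limit is negative; but the second hypothesis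
    makes that limit zero. *)
Lemma log_ratio_pos (p s : R) :
  12 / 10 <= p <= 125 / 100 -> ln 2 / p = ln (ln (3 + 2 * sqrt 2)) ->
  0 < s -> 0 < log_ratio p s.
Proof.
  intros Hp E Hs. apply Rnot_le_lt. intro Hle.
  assert (Hd : forall x, 0 < x ->
    is_derive (log_ratio p) x (slope_weight p x * slope p x)).
  { intros x Hx. apply is_derive_log_ratio; lra. }
  assert (Hc : exists c, 0 < c < s /\ slope p c <= 0).
  { apply Classical_Prop.NNPP. intro Hn.
    assert (Hinc : forall a b, 0 < a -> a < b -> b <= s ->
      log_ratio p a < log_ratio p b).
    { intros a b Ha Hab Hb. eapply increasing_of_deriv_pos; [exact Hab | |].
      - intros x Hx. apply Hd. lra.
      - intros x Hx. apply Rmult_lt_0_compat; [apply slope_weight_pos; lra|].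
        apply Rnot_le_lt. intro H. apply Hn. exists x. split; [lra | exact H]. }
    assert (Hneg : log_ratio p (s / 2) < 0)
      by (apply Rlt_le_trans with (2 := Hle); apply Hinc; lra).
    (* The second entry gives [log_ratio p (s / 2) < - d], against [- d <= log_ratio p d]; the first
       keeps [d] below [s / 2], where monotonicity applies. *)
    set (d := Rmin (s / 4) (- log_ratio p (s / 2) / 2)).
    assert (Hd0 : 0 < d) by (apply Rmin_pos; lra).
    assert (Hd1 : d <= s / 4) by apply Rmin_l.
    assert (Hd2 : d <= - log_ratio p (s / 2) / 2) by apply Rmin_r.
    pose proof (log_ratio_ge_opp p d ltac:(lra) Hd0).
    pose proof (Hinc d (s / 2) Hd0 ltac:(lra) ltac:(lra)). lra. }
  destruct Hc as [c [Hc Hsl]].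
  assert (Hdec : forall a b, s <= a -> a < b -> log_ratio p b < log_ratio p a).
  { intros a b Ha Hab. eapply decreasing_of_deriv_neg; [exact Hab | |].
    - intros x Hx. apply Hd. lra.
    - intros x Hx.
      pose proof (slope_weight_pos p x ltac:(lra)).
      pose proof (stays_negative_slope p Hp c x ltac:(lra) ltac:(lra) Hsl). nra. }
  (* Moving to [s + 1] buys strictness: the limit is at most the value there, which is below
     [log_ratio p s <= 0]. *)
  pose proof (Hdec s (s + 1) ltac:(lra) ltac:(lra)) as H1.
  assert (Hlim : Rbar_le (Finite (ln 2 / p - ln (ln (3 + 2 * sqrt 2))))
                         (Finite (log_ratio p (s + 1)))).
  { eapply (is_lim_le_loc (log_ratio p) (fun _ => log_ratio p (s + 1)) p_infty).
    - exists (s + 1). intros y Hy. apply Rlt_le, Hdec; lra.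
    - apply is_lim_log_ratio. lra.
    - apply is_lim_const. }
  simpl in Hlim. lra.
Qed.

(** * The means in exponential coordinates, and power means as functions of the order *)

Lemma arcsinh_opp (x : R) : arcsinh (- x) = - arcsinh x.
Proof.
  rewrite <- (arcsinh_sinh (- arcsinh x)). f_equal.
  rewrite <- (sinh_arcsinh x) at 1. unfold sinh. rewrite Ropp_involutive. field.
Qed.

Lemma NS_mean_sym (a b : R) : a <> b -> 0 < a + b -> NS_mean a b = NS_mean b a.
Proof.
  intros Hab H. unfold NS_mean.
  replace ((b - a) / (b + a)) with (- ((a - b) / (a + b))) by (field; lra).
  rewrite arcsinh_opp.
  assert (arcsinh ((a - b) / (a + b)) <> 0).
  { intro E. apply Hab. apply (f_equal sinh) in E.
    rewrite sinh_arcsinh, sinh_0 in E.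
    apply (f_equal (Rmult (a + b))) in E. field_simplify in E; lra. }
  field. lra.
Qed.

Lemma power_mean_sym (p a b : R) : power_mean p a b = power_mean p b a.
Proof. unfold power_mean. now rewrite (Rmult_comm a b), (Rplus_comm (Rpower a p)). Qed.

Lemma power_mean_pos (p a b : R) : 0 < a -> 0 < b -> 0 < power_mean p a b.
Proof.
  intros Ha Hb. unfold power_mean. destruct (Req_EM_T p 0).
  - apply sqrt_lt_R0. now apply Rmult_lt_0_compat.
  - apply exp_pos.
Qed.

Lemma pair_exp (a b : R) :
  0 < b < a ->
  exists m s, 0 < m /\ 0 < s /\ a = m * exp s /\ b = m * exp (- s).
Proof.
  (* [m] is the geometric mean, [s] half the logarithm of [a / b]. *)
  intro H. exists (exp ((ln a + ln b) / 2)), ((ln a - ln b) / 2).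
  pose proof (ln_increasing b a ltac:(lra) ltac:(lra)).
  repeat split; [apply exp_pos | lra | |]; rewrite <- exp_plus.
  - rewrite <- (exp_ln a) at 1 by lra. f_equal. field.
  - rewrite <- (exp_ln b) at 1 by lra. f_equal. field.
Qed.

Lemma NS_mean_exp (m s : R) :
  0 < m -> 0 < s ->
  NS_mean (m * exp s) (m * exp (- s)) = m * sinh s / arcsinh (tanh s).
Proof.
  intros Hm Hs. unfold NS_mean.
  pose proof (arcsinh_pos _ (tanh_pos s Hs)) as HL.
  pose proof (cosh_pos s) as Hc.
  assert (E : (m * exp s - m * exp (- s)) / (m * exp s + m * exp (- s)) = tanh s).
  { unfold tanh, sinh, cosh in *. field. split; [lra|]. nra. }
  rewrite E. unfold sinh. field. lra.
Qed.

Lemma power_mean_exp (p m s : R) :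
  p <> 0 -> 0 < m ->
  power_mean p (m * exp s) (m * exp (- s)) = m * exp (ln (cosh (p * s)) / p).
Proof.
  intros Hp Hm. unfold power_mean. destruct (Req_EM_T p 0) as [|_]; [easy|].
  unfold Rpower.
  rewrite !ln_mult, !ln_exp by (try apply exp_pos; exact Hm).
  replace ((exp (p * (ln m + s)) + exp (p * (ln m + - s))) / 2)
    with (exp (p * ln m) * cosh (p * s)).
  - rewrite ln_mult, ln_exp by (apply exp_pos || apply cosh_pos).
    rewrite <- (exp_ln m) at 2 by exact Hm.
    rewrite <- exp_plus. f_equal. field. exact Hp.
  - unfold cosh. rewrite !Rmult_plus_distr_l, !exp_plus.
    replace (p * - s) with (- (p * s)) by ring. field.
Qed.

Lemma power_mean_0_exp (m s : R) :
  0 < m -> power_mean 0 (m * exp s) (m * exp (- s)) = m.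
Proof.
  intro Hm. unfold power_mean. destruct (Req_EM_T 0 0) as [_|]; [|easy].
  replace (m * exp s * (m * exp (- s))) with (m * m * (exp s * exp (- s))) by ring.
  rewrite <- exp_plus, Rplus_opp_r, exp_0, Rmult_1_r. apply sqrt_square. lra.
Qed.

Lemma NS_mean_eq_exp (p m s : R) :
  p <> 0 -> 0 < m -> 0 < s ->
  NS_mean (m * exp s) (m * exp (- s))
  = power_mean p (m * exp s) (m * exp (- s)) * exp (log_ratio p s).
Proof.
  intros Hp Hm Hs. rewrite NS_mean_exp, power_mean_exp by assumption.
  unfold log_ratio, Rminus. rewrite !exp_plus, !exp_Ropp.
  pose proof (arcsinh_pos _ (tanh_pos s Hs)). pose proof (sinh_pos s Hs).
  rewrite !exp_ln by assumption.
  pose proof (exp_pos (ln (cosh (p * s)) / p)). field. split; lra.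
Qed.

Lemma NS_mean_over_power_mean (p a b : R) :
  p <> 0 -> 0 < a -> 0 < b -> a <> b ->
  exists s, 0 < s /\ NS_mean a b = power_mean p a b * exp (log_ratio p s).
Proof.
  intros Hp.
  assert (Hlt : forall a b, 0 < b < a ->
    exists s, 0 < s /\ NS_mean a b = power_mean p a b * exp (log_ratio p s)).
  { intros x y H. destruct (pair_exp x y H) as [m [s [Hm [Hs [-> ->]]]]].
    exists s. split; [exact Hs | now apply NS_mean_eq_exp]. }
  intros Ha Hb Hab. destruct (Rlt_or_le b a) as [H | H]; [now apply Hlt|].
  rewrite NS_mean_sym, power_mean_sym by lra. apply Hlt. lra.
Qed.

Lemma exists_pair_log_ratio (p s : R) :
  p <> 0 -> 0 < s ->
  exists a b, 0 < a /\ 0 < b /\ a <> b /\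
    NS_mean a b = power_mean p a b * exp (log_ratio p s).
Proof.
  intros Hp Hs. exists (1 * exp s), (1 * exp (- s)).
  pose proof (exp_pos s). pose proof (exp_pos (- s)).
  pose proof (exp_increasing (- s) s ltac:(lra)).
  repeat split; try lra. apply NS_mean_eq_exp; lra.
Qed.

(** [ln (cosh x)] vanishes at [0] and has the increasing derivative [tanh]; being convex, it has
    increasing chord slopes from the origin. *)
Lemma ln_cosh_div_le (t u : R) :
  0 < t -> t <= u -> ln (cosh t) / t <= ln (cosh u) / u.
Proof.
  intros Ht [Htu | <-]; [|lra].
  assert (Hd : forall x, is_derive (fun x => ln (cosh x)) x (tanh x)).
  { intro x. auto_derive; [apply cosh_pos | unfold tanh; field].
    apply Rgt_not_eq, cosh_pos. }
  destruct (MVT_is_derive _ _ 0 t Ht (fun x _ => Hd x)) as [c [Hc Ec]].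
  destruct (MVT_is_derive _ _ t u Htu (fun x _ => Hd x)) as [d [Hdd Ed]].
  simpl in Ec, Ed. rewrite cosh_0, ln_1 in Ec.
  assert (Hcd : tanh c < tanh d) by (apply tanh_lt; lra).
  apply (Rle_div_r _ _ u ltac:(lra)).
  replace (ln (cosh t)) with (tanh c * t) by lra.
  replace (ln (cosh u)) with (tanh c * t + tanh d * (u - t)) by lra.
  replace (tanh c * t / t * u) with (tanh c * u) by (field; lra). nra.
Qed.

(** Reduces every order [p <= p0] to [p0]. Positive orders are compared through [ln (cosh t) / t].
    For [p <= 0] the geometric mean [m] separates the two sides, since [ln (cosh x)] is
    nonnegative. *)
Lemma power_mean_le (p q a b : R) :
  0 < q -> p <= q -> 0 < a -> 0 < b -> power_mean p a b <= power_mean q a b.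
Proof.
  intros Hq Hpq.
  assert (Hlt : forall m s, 0 < m -> 0 < s ->
    power_mean p (m * exp s) (m * exp (- s))
    <= power_mean q (m * exp s) (m * exp (- s))).
  { intros m s Hm Hs. rewrite (power_mean_exp q) by lra.
    assert (Hln : forall x, 0 <= ln (cosh x)).
    { intro x. rewrite <- ln_1. apply ln_le; [lra|].
      destruct (Rle_or_lt 0 x); [now apply cosh_ge_1|].
      replace (cosh x) with (cosh (- x))
        by (unfold cosh; rewrite Ropp_involutive; field).
      apply cosh_ge_1. lra. }
    destruct (Req_dec p 0) as [-> | Hp].
    - rewrite power_mean_0_exp by exact Hm.
      assert (Hge : 1 <= exp (ln (cosh (q * s)) / q)).
      { rewrite <- exp_0. apply exp_le. apply Rdiv_le_0_compat; auto. }
      nra.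
    - rewrite power_mean_exp by assumption.
      apply Rmult_le_compat_l; [lra|]. apply exp_le.
      destruct (Rlt_or_le p 0) as [Hn | Hn].
      + apply Rle_trans with 0.
        * pose proof (Hln (p * s)). pose proof (Rinv_lt_0_compat p Hn).
          unfold Rdiv. nra.
        * apply Rdiv_le_0_compat; auto.
      + pose proof (ln_cosh_div_le (p * s) (q * s) ltac:(nra) ltac:(nra)) as H.
        apply (Rmult_le_compat_r s) in H; [|lra].
        replace (ln (cosh (p * s)) / (p * s) * s) with (ln (cosh (p * s)) / p) in H
          by (field; lra).
        replace (ln (cosh (q * s)) / (q * s) * s) with (ln (cosh (q * s)) / q) in H
          by (field; lra).
        exact H. }
  intros Ha Hb. destruct (Rtotal_order a b) as [H | [-> | H]].
  - rewrite !(power_mean_sym _ a b).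
    destruct (pair_exp b a ltac:(lra)) as [m [s [Hm [Hs [-> ->]]]]]. now apply Hlt.
  - assert (Hid : forall r, power_mean r b b = b).
    { intro r. replace b with (b * exp 0) at 1 by (rewrite exp_0; ring).
      replace b with (b * exp (- 0)) at 2 by (rewrite Ropp_0, exp_0; ring).
      destruct (Req_dec r 0) as [-> | Hr]; [now apply power_mean_0_exp|].
      rewrite power_mean_exp by assumption.
      rewrite Rmult_0_r, cosh_0, ln_1, Rdiv_0_l, exp_0. ring. }
    rewrite !Hid. lra.
  - destruct (pair_exp a b ltac:(lra)) as [m [s [Hm [Hs [-> ->]]]]]. now apply Hlt.
Qed.

(** * Taylor bounds for the exponential and the logarithm *)

Lemma exp_ge_step (T1 T2 T3 : R -> R) :
  (forall x, is_derive T2 x (T1 x)) -> (forall x, is_derive T3 x (T2 x)) ->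
  T2 0 = 1 -> T3 0 = 1 ->
  (forall x, T1 x <= exp x) -> forall x, T3 x <= exp x.
Proof.
  intros D2 D3 E2 E3 H1.
  assert (De2 : forall x, is_derive (fun x => exp x - T2 x) x (exp x - T1 x)).
  { intro x. apply (is_derive_minus exp T2); [apply is_derive_exp | apply D2]. }
  assert (De3 : forall x, is_derive (fun x => exp x - T3 x) x (exp x - T2 x)).
  { intro x. apply (is_derive_minus exp T3); [apply is_derive_exp | apply D3]. }
  (* [exp - T2] is nondecreasing and vanishes at [0], so [exp - T3] has its minimum there, and that
     minimum is [0]. *)
  assert (Mono : forall x y, x < y -> exp x - T2 x <= exp y - T2 y).
  { intros x y Hxy.
    destruct (MVT_is_derive _ _ x y Hxy (fun z _ => De2 z)) as [c [_ E]].
    specialize (H1 c). simpl in E. nra. }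
  intro x. destruct (Rtotal_order x 0) as [Hx | [-> | Hx]].
  - destruct (MVT_is_derive _ _ x 0 Hx (fun z _ => De3 z)) as [c [Hc E]].
    simpl in E. rewrite exp_0, E3 in E.
    pose proof (Mono c 0 ltac:(lra)) as M. rewrite exp_0, E2 in M. nra.
  - rewrite exp_0. lra.
  - destruct (MVT_is_derive _ _ 0 x Hx (fun z _ => De3 z)) as [c [Hc E]].
    simpl in E. rewrite exp_0, E3 in E.
    pose proof (Mono 0 c ltac:(lra)) as M. rewrite exp_0, E2 in M. nra.
Qed.

(** The Taylor polynomial of degree 11 in Horner form. The odd degree makes it a lower bound for
    [exp] on the whole line, negative arguments included. *)
Definition exp_taylor11 (x : R) : R :=
  1 + x * (1 + x / 2 * (1 + x / 3 * (1 + x / 4 * (1 + x / 5 * (1 + x / 6 *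
  (1 + x / 7 * (1 + x / 8 * (1 + x / 9 * (1 + x / 10 * (1 + x / 11)))))))))).

Lemma exp_taylor11_le (x : R) : exp_taylor11 x <= exp x.
Proof.
  revert x. unfold exp_taylor11.
  apply exp_ge_step with
    (fun x => 1 + x * (1 + x / 2 * (1 + x / 3 * (1 + x / 4 * (1 + x / 5 *
      (1 + x / 6 * (1 + x / 7 * (1 + x / 8 * (1 + x / 9)))))))))
    (fun x => 1 + x * (1 + x / 2 * (1 + x / 3 * (1 + x / 4 * (1 + x / 5 *
      (1 + x / 6 * (1 + x / 7 * (1 + x / 8 * (1 + x / 9 * (1 + x / 10))))))))));
  try (intro x; auto_derive; [easy | field]); try lra.
  apply exp_ge_step with
    (fun x => 1 + x * (1 + x / 2 * (1 + x / 3 * (1 + x / 4 * (1 + x / 5 *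
      (1 + x / 6 * (1 + x / 7)))))))
    (fun x => 1 + x * (1 + x / 2 * (1 + x / 3 * (1 + x / 4 * (1 + x / 5 *
      (1 + x / 6 * (1 + x / 7 * (1 + x / 8))))))));
  try (intro x; auto_derive; [easy | field]); try lra.
  apply exp_ge_step with
    (fun x => 1 + x * (1 + x / 2 * (1 + x / 3 * (1 + x / 4 * (1 + x / 5)))))
    (fun x => 1 + x * (1 + x / 2 * (1 + x / 3 * (1 + x / 4 * (1 + x / 5 *
      (1 + x / 6))))));
  try (intro x; auto_derive; [easy | field]); try lra.
  apply exp_ge_step with
    (fun x => 1 + x * (1 + x / 2 * (1 + x / 3)))
    (fun x => 1 + x * (1 + x / 2 * (1 + x / 3 * (1 + x / 4))));
  try (intro x; auto_derive; [easy | field]); try lra.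
  apply exp_ge_step with (fun x => 1 + x) (fun x => 1 + x * (1 + x / 2));
  try (intro x; auto_derive; [easy | field]); try lra.
  intro x. destruct (Req_dec x 0) as [-> | Hx]; [rewrite exp_0; lra|].
  apply Rlt_le, exp_ineq1, Hx.
Qed.

(** An upper bound at [x] is a lower bound at [- x], inverted; one polynomial thus serves both
    directions. *)
Lemma exp_le_of_taylor (x y : R) : 0 < y -> 1 <= y * exp_taylor11 (- x) -> exp x <= y.
Proof.
  intros Hy H. pose proof (exp_taylor11_le (- x)) as T.
  pose proof (exp_pos x) as Hx. rewrite exp_Ropp in T.
  assert (1 <= y * / exp x) by nra.
  apply (Rmult_le_compat_r (exp x)) in H0; [|lra].
  rewrite Rmult_assoc, Rinv_l in H0; lra.
Qed.

Lemma ln_ge_of_taylor (x y : R) : 0 < y -> 1 <= y * exp_taylor11 (- x) -> x <= ln y.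
Proof.
  intros Hy H. rewrite <- (ln_exp x). apply ln_le; [apply exp_pos|].
  now apply exp_le_of_taylor.
Qed.

Lemma ln_le_of_taylor (x y : R) : 0 < y -> y <= exp_taylor11 x -> ln y <= x.
Proof.
  intros Hy H. rewrite <- (ln_exp x). apply ln_le; [exact Hy|].
  apply Rle_trans with (1 := H), exp_taylor11_le.
Qed.

Ltac taylor := unfold exp_taylor11; lra.

Lemma ln_bounds (xl xu y : R) :
  0 < y -> 1 <= y * exp_taylor11 (- xl) -> y <= exp_taylor11 xu -> xl <= ln y <= xu.
Proof.
  intros. split; [now apply ln_ge_of_taylor | now apply ln_le_of_taylor].
Qed.

(** * Decimal bounds for [p0] *)

Lemma sqrt_bounds (l u y : R) :
  0 <= l -> 0 <= u -> l * l <= y <= u * u -> l <= sqrt y <= u.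
Proof.
  intros Hl Hu H. split.
  - rewrite <- (sqrt_square l) by exact Hl. apply sqrt_le_1_alt. lra.
  - rewrite <- (sqrt_square u) by exact Hu. apply sqrt_le_1_alt. lra.
Qed.

Lemma ln_2_bounds : 0.6931471 <= ln 2 <= 0.6931472.
Proof. apply ln_bounds; [lra | taylor | taylor]. Qed.

Lemma arcsinh_1_bounds : 0.88137355 <= arcsinh 1 <= 0.8813736.
Proof.
  unfold arcsinh. replace (1 ^ 2 + 1) with 2 by ring.
  pose proof (sqrt_bounds 1.41421356 1.41421357 2 ltac:(lra) ltac:(lra) ltac:(lra)).
  split; [apply ln_ge_of_taylor | apply ln_le_of_taylor]; try taylor.
Qed.

Lemma ln_ln_bounds : 0.5668734 <= ln (ln (3 + 2 * sqrt 2)) <= 0.5668736.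
Proof.
  rewrite ln_3_2sqrt2. pose proof arcsinh_1_bounds.
  split; [apply ln_ge_of_taylor | apply ln_le_of_taylor]; try taylor.
Qed.

Lemma p0_bounds : 1.222754 <= p0 <= 1.222755.
Proof.
  pose proof ln_ln_bounds. pose proof ln_2_bounds. unfold p0. split.
  - apply -> Rle_div_r; lra.
  - apply Rle_div_l; lra.
Qed.

(** * Evaluation at logarithms of rationals *)

Lemma cosh_of_exp (c k : R) : exp c = k -> cosh c = (k + / k) / 2.
Proof. intro E. unfold cosh. now rewrite exp_Ropp, E. Qed.

Lemma sinh_of_exp (c k : R) : exp c = k -> sinh c = (k - / k) / 2.
Proof. intro E. unfold sinh. now rewrite exp_Ropp, E. Qed.

Lemma tanh_of_exp (c k : R) : 0 < k -> exp c = k -> tanh c = (k ^ 2 - 1) / (k ^ 2 + 1).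
Proof.
  intros Hk E. unfold tanh. rewrite (sinh_of_exp c k E), (cosh_of_exp c k E).
  field. repeat split; nra.
Qed.

(** At [s = ln k] the hyperbolic functions become rational in [k] and [exp (p * ln k)], ready for
    rational estimates. *)
Lemma slope_ln (p k : R) :
  0 < k ->
  slope p (ln k)
  = arcsinh ((k ^ 2 - 1) / (k ^ 2 + 1))
    - (k ^ 2 - 1) / (k ^ 2 + 1)
      * (k * (exp (p * ln k) ^ 2 + 1) / (exp (p * ln k) ^ 2 + k ^ 2))
      / sqrt ((k ^ 2 + / k ^ 2) / 2).
Proof.
  intro Hk. unfold slope.
  set (Y := exp (p * ln k)). assert (HY : 0 < Y) by apply exp_pos.
  rewrite (tanh_of_exp (ln k) k Hk (exp_ln k Hk)).
  rewrite (cosh_of_exp (p * ln k) Y eq_refl).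
  rewrite (cosh_of_exp ((p - 1) * ln k) (Y / k)).
  2:{ unfold Y. replace ((p - 1) * ln k) with (p * ln k - ln k) by ring.
      unfold Rminus. now rewrite exp_plus, exp_Ropp, exp_ln. }
  rewrite (cosh_of_exp (2 * ln k) (k ^ 2)).
  2:{ replace (2 * ln k) with (ln k + ln k) by ring.
      rewrite exp_plus, exp_ln by exact Hk. ring. }
  assert (0 < sqrt ((k ^ 2 + / k ^ 2) / 2)).
  { apply sqrt_lt_R0. assert (0 < k ^ 2) by nra.
    pose proof (Rinv_0_lt_compat _ H). lra. }
  field. repeat split; nra.
Qed.

Lemma ln_5_2_bounds : 0.9162907 <= ln (5 / 2) <= 0.9162908.
Proof. apply ln_bounds; [lra | taylor | taylor]. Qed.

Lemma ln_13_5_bounds : 0.9555 <= ln (13 / 5) <= 0.9556.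
Proof. apply ln_bounds; [lra | taylor | taylor]. Qed.

Lemma arcsinh_21_29_bounds : 0.672329 <= arcsinh (21 / 29) <= 0.67232902.
Proof.
  unfold arcsinh.
  pose proof (sqrt_bounds 1.234656123 1.2346561235 ((21 / 29) ^ 2 + 1)
    ltac:(lra) ltac:(lra) ltac:(lra)).
  split; [apply ln_ge_of_taylor | apply ln_le_of_taylor]; try taylor.
Qed.

Lemma arcsinh_72_97_le : arcsinh (72 / 97) <= 0.68696.
Proof.
  unfold arcsinh.
  pose proof (sqrt_bounds 1.2453 1.245377 ((72 / 97) ^ 2 + 1)
    ltac:(lra) ltac:(lra) ltac:(lra)).
  apply ln_le_of_taylor; try taylor.
Qed.

Lemma exp_p_ln_5_2_bounds (p : R) :
  1.222754 <= p <= 1.222755 -> 3.066074 <= exp (p * ln (5 / 2)) <= 3.066079.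
Proof.
  intro Hp. pose proof ln_5_2_bounds.
  split.
  (* The rational exponents [1.120398] and [1.1203992] enclose [p * ln (5 / 2)]. *)
  - apply Rle_trans with (exp 1.120398).
    + apply Rle_trans with (2 := exp_taylor11_le _). taylor.
    + apply exp_le. nra.
  - apply Rle_trans with (exp 1.1203992).
    + apply exp_le. nra.
    + apply exp_le_of_taylor; [lra | taylor].
Qed.

Lemma exp_p_ln_13_5_ge (p : R) :
  1.222754 <= p <= 1.222755 -> 3.2166 <= exp (p * ln (13 / 5)).
Proof.
  intro Hp. pose proof ln_13_5_bounds.
  apply Rle_trans with (exp 1.168341).
  - apply Rle_trans with (2 := exp_taylor11_le _). taylor.
  - apply exp_le. nra.
Qed.

(** The lower bound will give [beta2 >= 1.01375]; the upper one is the base value for estimating the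
    maximum. *)
Lemma log_ratio_ln_5_2_bounds (p : R) :
  1.222754 <= p <= 1.222755 -> 0.0137 <= log_ratio p (ln (5 / 2)) <= 0.013712.
Proof.
  intro Hp. unfold log_ratio.
  pose proof (exp_p_ln_5_2_bounds p Hp) as HY.
  set (Y := exp (p * ln (5 / 2))) in HY.
  rewrite (tanh_of_exp _ (5 / 2)), (sinh_of_exp _ (5 / 2)), (cosh_of_exp _ Y)
    by (solve [lra | reflexivity | apply exp_ln; lra]).
  replace (((5 / 2) ^ 2 - 1) / ((5 / 2) ^ 2 + 1)) with (21 / 29) by field.
  replace ((5 / 2 - / (5 / 2)) / 2) with (21 / 20) by field.
  pose proof arcsinh_21_29_bounds as HL.
  assert (H1 : 0.0487901 <= ln (21 / 20) <= 0.0487902)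
    by (apply ln_bounds; [lra | taylor | taylor]).
  assert (H2 : -0.3970076 <= ln (arcsinh (21 / 29)) <= -0.3970073).
  { apply ln_bounds; [lra | taylor | taylor]. }
  assert (Hinv : 0.3261494 <= / Y <= 0.32615).
  { split.
    - apply Rle_trans with (/ 3.066079); [lra | apply Rinv_le_contravar; lra].
    - apply Rle_trans with (/ 3.066074); [apply Rinv_le_contravar; lra | lra]. }
  assert (H3 : 0.528337 <= ln ((Y + / Y) / 2) <= 0.528341).
  { apply ln_bounds; [lra | taylor | taylor]. }
  assert (H4 : 0.432087 <= ln ((Y + / Y) / 2) / p <= 0.432092).
  { split; [apply -> Rle_div_r | apply Rle_div_l]; nra. }
  lra.
Qed.

(** Positivity shows that the maximum of [log_ratio p] lies beyond [ln (5 / 2)]; the upper bound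
    limits the gain still possible. *)
Lemma slope_ln_5_2_bounds (p : R) :
  1.222754 <= p <= 1.222755 -> 0.0001 <= slope p (ln (5 / 2)) <= 0.00034.
Proof.
  intro Hp. rewrite slope_ln by lra.
  pose proof (exp_p_ln_5_2_bounds p Hp) as HY.
  set (Y := exp (p * ln (5 / 2))) in *.
  replace (((5 / 2) ^ 2 - 1) / ((5 / 2) ^ 2 + 1)) with (21 / 29) by field.
  pose proof arcsinh_21_29_bounds as HL.
  pose proof (sqrt_bounds 1.790251 1.790252 (((5 / 2) ^ 2 + / (5 / 2) ^ 2) / 2)
    ltac:(lra) ltac:(lra) ltac:(lra)) as HW.
  set (W := sqrt _) in *.
  set (Q := 5 / 2 * (Y ^ 2 + 1) / (Y ^ 2 + (5 / 2) ^ 2)).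
  assert (HQ : 1.66138 <= Q <= 1.66139).
  { unfold Q. split; [apply -> Rle_div_r | apply Rle_div_l]; nra. }
  assert (0.67199 <= 21 / 29 * Q / W <= 0.6721).
  { split; [apply -> Rle_div_r | apply Rle_div_l]; nra. }
  lra.
Qed.

Lemma slope_ln_13_5_neg (p : R) :
  1.222754 <= p <= 1.222755 -> slope p (ln (13 / 5)) < 0.
Proof.
  intro Hp. rewrite slope_ln by lra.
  pose proof (exp_p_ln_13_5_ge p Hp) as HY.
  set (Y := exp (p * ln (13 / 5))) in *.
  replace (((13 / 5) ^ 2 - 1) / ((13 / 5) ^ 2 + 1)) with (72 / 97) by field.
  pose proof arcsinh_72_97_le as HL.
  pose proof (sqrt_bounds 1.8584 1.8585 (((13 / 5) ^ 2 + / (13 / 5) ^ 2) / 2)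
    ltac:(lra) ltac:(lra) ltac:(lra)) as HW.
  set (W := sqrt _) in *.
  set (Q := 13 / 5 * (Y ^ 2 + 1) / (Y ^ 2 + (13 / 5) ^ 2)).
  assert (HQ : 1.724 <= Q).
  { unfold Q. apply -> Rle_div_r; nra. }
  assert (0.688 <= 72 / 97 * Q / W).
  { apply -> Rle_div_r; nra. }
  lra.
Qed.

(** Makes [slope p] decrease from [ln (5 / 2)] on, so that its value there bounds it up to the
    maximum of [log_ratio p]. *)
Lemma slope_numer_ln_5_2_neg (p : R) :
  1.222754 <= p <= 1.222755 -> slope_numer (2 * p - 1) (ln (5 / 2)) < 0.
Proof.
  intro Hp. unfold slope_numer.
  pose proof (exp_p_ln_5_2_bounds p Hp) as HY.
  set (Y := exp (p * ln (5 / 2))) in HY.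
  assert (Ek : exp (ln (5 / 2)) = 5 / 2) by (apply exp_ln; lra).
  set (k := ln (5 / 2)) in *.
  rewrite (cosh_of_exp (5 * k) ((5 / 2) ^ 5)).
  2:{ replace (5 * k) with (k + k + k + k + k) by ring.
      rewrite !exp_plus, Ek. ring. }
  rewrite (cosh_of_exp (3 * k) ((5 / 2) ^ 3)).
  2:{ replace (3 * k) with (k + k + k) by ring. rewrite !exp_plus, Ek. ring. }
  rewrite (cosh_of_exp ((4 - (2 * p - 1)) * k) ((5 / 2) ^ 5 / Y ^ 2)).
  2:{ replace ((4 - (2 * p - 1)) * k)
        with (k + k + k + k + k + - (p * k) + - (p * k)) by ring.
      rewrite !exp_plus, exp_Ropp, Ek. fold Y. field. lra. }
  rewrite (cosh_of_exp ((2 + (2 * p - 1)) * k) (5 / 2 * Y ^ 2)).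
  2:{ replace ((2 + (2 * p - 1)) * k) with (k + p * k + p * k) by ring.
      rewrite !exp_plus, Ek. fold Y. ring. }
  (* These two cosines carry the coefficient [-2], so their positivity suffices. *)
  pose proof (cosh_pos ((2 - (2 * p - 1)) * k)). pose proof (cosh_pos k).
  assert (HZ : 9.4 <= Y ^ 2 <= 9.401) by nra.
  set (Z := Y ^ 2) in *.
  assert (H1 : (5 / 2) ^ 5 / Z <= 10.39) by (apply Rle_div_l; lra).
  assert (H2 : / ((5 / 2) ^ 5 / Z) <= 0.1).
  { rewrite Rinv_div. apply Rle_div_l; lra. }
  assert (H3 : 0 < / (5 / 2 * Z)) by (apply Rinv_0_lt_compat; lra).
  lra.
Qed.

(** * The upper bound on the log ratio *)

Lemma slope_weight_le (p s : R) :
  1 <= p -> ln (5 / 2) <= s -> slope_weight p s <= 1.42.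
Proof.
  intros Hp Hs. pose proof ln_5_2_bounds as Hk.
  assert (Hsh : 21 / 20 <= sinh s).
  { replace (21 / 20) with (sinh (ln (5 / 2)))
      by (rewrite (sinh_of_exp _ (5 / 2)) by (apply exp_ln; lra); field).
    destruct Hs as [Hs | <-]; [now apply Rlt_le, sinh_lt | lra]. }
  assert (HL : 0.672 <= arcsinh (tanh s)).
  { apply Rle_trans with (arcsinh (21 / 29));
      [pose proof arcsinh_21_29_bounds; lra|].
    apply arcsinh_le.
    replace (21 / 29) with (tanh (ln (5 / 2)))
      by (rewrite (tanh_of_exp _ (5 / 2)) by (try apply exp_ln; lra); field).
    destruct Hs as [Hs | <-]; [now apply Rlt_le, tanh_lt | lra]. }
  (* This leaves [1 / (sinh s * arcsinh (tanh s))], which decreases in [s] and is about [1.417] at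
     [ln (5 / 2)]. *)
  assert (Hc : cosh ((p - 1) * s) <= cosh (p * s)) by (apply cosh_le; nra).
  pose proof (cosh_pos (p * s)) as Hcp.
  unfold slope_weight.
  assert (H1 : 21 / 20 * cosh (p * s) <= sinh s * cosh (p * s)) by nra.
  assert (H2 : 21 / 20 * cosh (p * s) * 0.672
               <= sinh s * cosh (p * s) * arcsinh (tanh s))
    by (apply Rmult_le_compat; nra).
  apply Rle_div_l; lra.
Qed.

(* [log_ratio p] increases up to the zero of [slope p], which lies between
   [ln (5/2)] and [ln (13/5)]; there its derivative is at most
   [1.42 * slope p (ln (5/2))] because [slope p] is already decreasing. *)
Lemma log_ratio_le (p s : R) :
  1.222754 <= p <= 1.222755 -> 0 < s -> log_ratio p s <= 0.01374.
Proof.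
  intros Hp Hs.
  pose proof ln_5_2_bounds as Hc1. pose proof ln_13_5_bounds as Hc2.
  pose proof (log_ratio_ln_5_2_bounds p Hp) as Hf.
  pose proof (slope_ln_5_2_bounds p Hp) as Hg1.
  pose proof (slope_ln_13_5_neg p Hp) as Hg2.
  pose proof (slope_numer_ln_5_2_neg p Hp) as Hn.
  pose proof (slope_weight_le p) as Hw.
  set (c1 := ln (5 / 2)) in *. set (c2 := ln (13 / 5)) in *.
  assert (Hsn : stays_negative (slope p)) by (apply stays_negative_slope; lra).
  assert (Hd : forall x, 0 < x ->
    is_derive (log_ratio p) x (slope_weight p x * slope p x)).
  { intros x Hx. apply is_derive_log_ratio; lra. }
  assert (Hmid : forall x, c1 <= x <= c2 -> log_ratio p x <= 0.01374).
  { intros x [[Hx | <-] Hx2]; [|lra].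
    destruct (MVT_is_derive (log_ratio p) (fun x => slope_weight p x * slope p x)
                c1 x Hx) as [c [Hc E]].
    { intros y Hy. apply Hd. lra. }
    assert (Hs1 : slope p c < slope p c1)
      by (apply slope_decreasing; lra).
    assert (slope_weight p c * slope p c <= 1.42 * 0.00034).
    { pose proof (Hw c ltac:(lra) ltac:(lra)).
      pose proof (slope_weight_pos p c ltac:(lra)). nra. }
    (* [0.04] exceeds [c2 - c1]; the resulting gain of about [0.00002] fits between [0.013712] and
       [0.01374]. *)
    assert (slope_weight p c * slope p c * (x - c1) <= 1.42 * 0.00034 * 0.04)
      by nra.
    lra. }
  destruct (Rlt_or_le s c1) as [H1 | H1].
  - enough (log_ratio p s < log_ratio p c1) by lra.
    eapply increasing_of_deriv_pos; [exact H1 | |].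
    + intros x Hx. apply Hd. lra.
    + intros x Hx. apply Rmult_lt_0_compat; [apply slope_weight_pos; lra|].
      apply Rnot_le_lt. intro H.
      pose proof (Hsn x c1 ltac:(lra) ltac:(lra) H). lra.
  - destruct (Rle_or_lt s c2) as [H2 | H2]; [apply Hmid; lra|].
    enough (log_ratio p s < log_ratio p c2) by (pose proof (Hmid c2); lra).
    eapply decreasing_of_deriv_neg; [exact H2 | |].
    + intros x Hx. apply Hd. lra.
    + intros x Hx. pose proof (slope_weight_pos p x ltac:(lra)).
      pose proof (Hsn c2 x ltac:(lra) ltac:(lra) ltac:(lra)). nra.
Qed.

(** * The order [p0] and the best constants *)

Lemma ln_2_div_p0 : ln 2 / p0 = ln (ln (3 + 2 * sqrt 2)).
Proof.
  pose proof ln_2_bounds. pose proof ln_ln_bounds. unfold p0. field. lra.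
Qed.

Lemma log_ratio_p0_pos (s : R) : 0 < s -> 0 < log_ratio p0 s.
Proof.
  pose proof p0_bounds. apply log_ratio_pos; [lra | apply ln_2_div_p0].
Qed.

Lemma power_mean_lt_NS_mean (a b : R) :
  0 < a -> 0 < b -> a <> b -> power_mean p0 a b < NS_mean a b.
Proof.
  intros Ha Hb Hab. pose proof p0_bounds.
  destruct (NS_mean_over_power_mean p0 a b ltac:(lra) Ha Hb Hab) as [s [Hs ->]].
  pose proof (power_mean_pos p0 a b Ha Hb).
  pose proof (exp_increasing 0 _ (log_ratio_p0_pos s Hs)) as He.
  rewrite exp_0 in He. nra.
Qed.

(* As [s] tends to infinity, [N / A_p] tends to
   [2 ^ (1 / p) / ln (3 + 2 sqrt 2)], which is below [1] when [p > p0]. *)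
Lemma le_p0_of_power_mean_lt (p : R) :
  (forall a b, 0 < a -> 0 < b -> a <> b -> NS_mean a b > power_mean p a b) ->
  p <= p0.
Proof.
  intro H. apply Rnot_lt_le. intro Hp. pose proof p0_bounds as Hp0.
  assert (Hlim : Rbar_le (Finite 0) (Finite (ln 2 / p - ln (ln (3 + 2 * sqrt 2))))).
  { eapply (is_lim_le_loc (fun _ => 0) (log_ratio p) p_infty).
    - exists 0. intros s Hs.
      destruct (exists_pair_log_ratio p s ltac:(lra) Hs)
        as [a [b [Ha [Hb [Hab E]]]]].
      specialize (H a b Ha Hb Hab). rewrite E in H.
      pose proof (power_mean_pos p a b Ha Hb).
      apply Rlt_le, exp_lt_inv. rewrite exp_0. nra.
    - apply is_lim_const.
    - apply is_lim_log_ratio. lra. }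
  simpl in Hlim. rewrite <- ln_2_div_p0 in Hlim.
  pose proof ln_2_bounds.
  assert (/ p < / p0) by (apply Rinv_lt_contravar; nra).
  unfold Rdiv in Hlim. nra.
Qed.

(** The ratio of the means is [exp (log_ratio p0 s)], and it tends to [1] as [s] goes to
    infinity. *)
Lemma le_1_of_scaled_power_mean_lt (alpha : R) :
  (forall a b, 0 < a -> 0 < b -> a <> b -> alpha * power_mean p0 a b < NS_mean a b) ->
  alpha <= 1.
Proof.
  intro H. pose proof p0_bounds as Hp0.
  assert (Hlim : Rbar_le (Finite alpha) (Finite 1)).
  { eapply (is_lim_le_loc (fun _ => alpha) (fun s => exp (log_ratio p0 s)) p_infty).
    - exists 0. intros s Hs.
      destruct (exists_pair_log_ratio p0 s ltac:(lra) Hs)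
        as [a [b [Ha [Hb [Hab E]]]]].
      specialize (H a b Ha Hb Hab). rewrite E in H.
      pose proof (power_mean_pos p0 a b Ha Hb). nra.
    - apply is_lim_const.
    - rewrite <- exp_0.
      replace 0 with (ln 2 / p0 - ln (ln (3 + 2 * sqrt 2)))
        by (rewrite ln_2_div_p0; ring).
      eapply (filterlim_comp _ _ _ (log_ratio p0) exp).
      + apply is_lim_log_ratio. lra.
      + apply (ex_derive_continuous exp). auto_derive. easy. }
  exact Hlim.
Qed.

(* The best upper constant beta2 is the maximum of N / A_{p0}, attained at a
   pair with a <> b (ratio about 6.33), so the upper bound with beta2 itself
   can only hold with <=.  The decimal approximations are read as
   correct to the printed digits. *)
Theorem theorem2 :
  Rabs (p0 - 1.2228) <= 0.00005 /\
  (forall p : R,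
     (forall a b : R, 0 < a -> 0 < b -> a <> b ->
        NS_mean a b > power_mean p a b) <-> p <= p0) /\
  exists beta2 : R,
    Rabs (beta2 - 1.0138) <= 0.00005 /\
    (forall a b : R, 0 < a -> 0 < b -> a <> b ->
       1 * power_mean p0 a b < NS_mean a b /\
       NS_mean a b <= beta2 * power_mean p0 a b) /\
    (forall alpha : R,
       (forall a b : R, 0 < a -> 0 < b -> a <> b ->
          alpha * power_mean p0 a b < NS_mean a b) -> alpha <= 1) /\
    (forall beta : R,
       (forall a b : R, 0 < a -> 0 < b -> a <> b ->
          NS_mean a b < beta * power_mean p0 a b) -> beta2 <= beta).
Proof.
  pose proof p0_bounds as Hp0.
  split; [apply Rabs_le; lra|]. split.
  { intro p. split; [apply le_p0_of_power_mean_lt|].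
    intros Hp a b Ha Hb Hab.
    apply Rle_lt_trans with (power_mean p0 a b).
    - apply power_mean_le; lra.
    - now apply power_mean_lt_NS_mean. }
  (* Taking [beta2] as the supremum of the ratios makes it best possible by construction and avoids
     locating the maximiser. Its decimals only require that it lie between [1.01375] and
     [1.01385]. *)
  set (ratios := fun x => exists s, 0 < s /\ x = exp (log_ratio p0 s)).
  assert (Hub : is_upper_bound ratios 1.01385).
  { intros x [s [Hs ->]]. apply Rle_trans with (exp 0.01374).
    - apply exp_le, log_ratio_le; assumption.
    - apply exp_le_of_taylor; [lra | taylor]. }
  assert (Hc : 0 < ln (5 / 2)) by (pose proof ln_5_2_bounds; lra).
  assert (Hin : ratios (exp (log_ratio p0 (ln (5 / 2)))))
    by (exists (ln (5 / 2)); now split).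
  destruct (completeness ratios) as [beta2 [Hb2 Hleast]].
  { now exists 1.01385. }
  { eexists. exact Hin. }
  exists beta2. split; [|split; [|split]].
  - apply Rabs_le. specialize (Hleast _ Hub). specialize (Hb2 _ Hin).
    assert (1.01375 <= exp (log_ratio p0 (ln (5 / 2)))).
    { apply Rle_trans with (exp 0.0137).
      - apply Rle_trans with (2 := exp_taylor11_le _). taylor.
      - apply exp_le. now apply log_ratio_ln_5_2_bounds. }
    lra.
  - intros a b Ha Hb Hab. split.
    + rewrite Rmult_1_l. now apply power_mean_lt_NS_mean.
    + destruct (NS_mean_over_power_mean p0 a b ltac:(lra) Ha Hb Hab) as [s [Hs ->]].
      rewrite (Rmult_comm beta2). apply Rmult_le_compat_l.
      * now apply Rlt_le, power_mean_pos.
      * apply Hb2. exists s. now split.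
  - apply le_1_of_scaled_power_mean_lt.
  (* Every ratio is realised by a pair, so an admissible [beta] is an upper bound of [ratios]. *)
  - intros beta H. apply Hleast. intros x [s [Hs ->]].
    destruct (exists_pair_log_ratio p0 s ltac:(lra) Hs)
      as [a [b [Ha [Hb [Hab E]]]]].
    specialize (H a b Ha Hb Hab). rewrite E in H.
    pose proof (power_mean_pos p0 a b Ha Hb). nra.
Qed.
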